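(* For every $n\in\mathbb{N}$, the graph $G(3,5,n)$ is connected and has diameter at most $4$.
   Context: For a prime $p$ and $n\in\mathbb{N}$, $G(p,n)$ is the simple graph with vertex set $\{2,4,\ldots,2n\}$ in which two distinct vertices $a,b$ are adjacent if and only if both $\frac{a+b}{2}$ and $\frac{|a-b|}{2}$ are odd positive integers neither of which equals $pk$ for an integer $k\ge 2$. $G(3,5,n)$ is the intersection of $G(3,n)$ and $G(5,n)$: the graph on $\{2,4,\ldots,2n\}$ whose edge set is the intersection of their edge sets (equivalently, $a,b$ adjacent iff $\frac{a+b}{2},\frac{|a-b|}{2}$ are odd positive integers, none a multiple $3k$ or $5k$ with $k\ge 2$). *)

(* Defs.v *)
From mathcomp Require Import all_boot ssrint.

Set Implicit Arguments.
Unset Strict Implicit.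
Unset Printing Implicit Defensive.

Record sgraph (T : finType) := SGraph {
  edge : rel T;
  edge_sym : symmetric edge;
  edge_irr : irreflexive edge
}.

Section SGraph.
Variable T : finType.
Implicit Types (G H : sgraph T) (x y : T).

Lemma sg_inter_sym G H : symmetric [rel x y | edge G x y && edge H x y].
Proof. by move=> x y /=; rewrite (edge_sym G) (edge_sym H). Qed.

Lemma sg_inter_irr G H : irreflexive [rel x y | edge G x y && edge H x y].
Proof. by move=> x /=; rewrite edge_irr. Qed.

Definition sg_inter G H : sgraph T :=
  SGraph (@sg_inter_sym G H) (@sg_inter_irr G H).

(* The graph without vertices counts as connected. *)
Definition sg_connected G : Prop := forall x y, connect (edge G) x y.

Definition has_walk G (k : nat) x y : bool :=
  [exists s : k.-tuple T, path (edge G) x s && (last x s == y)].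

(* Least length of a walk from x to y. Such a length is below #|T|, so the
   value #|T| is taken exactly when y cannot be reached from x. *)
Definition sg_dist G x y : nat :=
  find (fun k => has_walk G k x y) (iota 0 #|T|).

Definition sg_diam G : nat := \max_(x : T) \max_(y : T) sg_dist G x y.

End SGraph.

Definition vertex (n : nat) : finType :=
  {a : 'I_(2 * n).+1 | (0 < a) && ~~ odd a}.

Definition vertex_val n (a : vertex n) : nat := val (val a).

Definition proper_multiple (p m : nat) : bool := (p %| m) && (2 <= m %/ p).

Lemma proper_multipleP p m : prime p ->
  reflect (exists2 k, 2 <= k & m = p * k) (proper_multiple p m).
Proof.
move=> /prime_gt0 p0; apply: (iffP andP) => [[pm k2]|[k k2 ->]].
  by exists (m %/ p) => //; rewrite mulnC divnK.
by rewrite dvdn_mulr // mulKn.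
Qed.

Definition admissible (p m : nat) : bool := odd m && ~~ proper_multiple p m.

(* Vertices are even, so both halves are exact. *)
Definition adj (p n : nat) : rel (vertex n) := fun a b =>
  admissible p ((vertex_val a + vertex_val b) %/ 2)
  && admissible p (`|vertex_val a - vertex_val b|%N %/ 2).

Lemma adj_sym p n : symmetric (@adj p n).
Proof. by move=> a b; rewrite /adj addnC distnC. Qed.

Lemma adj_irr p n : irreflexive (@adj p n).
Proof. by move=> a; rewrite /adj distnn andbF. Qed.

Definition Gpn (p n : nat) : sgraph (vertex n) :=
  SGraph (@adj_sym p n) (@adj_irr p n).

Definition G35 (n : nat) : sgraph (vertex n) := sg_inter (Gpn 3 n) (Gpn 5 n).

(* Main.v *)
Require Import Defs.
From mathcomp Require Import all_boot.
From mathcomp Require Import ssrint zify.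

Set Implicit Arguments.
Unset Strict Implicit.
Unset Printing Implicit Defensive.

(** Halve every vertex, so that the vertices are [1, ..., n]. If [x + y] and
    [x - y] are prime to [30] then [x] and [y] are adjacent, and this depends
    only on the residues of [x] and [y] modulo [30]. Such edges alone leave the
    graph disconnected, since they change both the parity and the divisibility
    by [3]; the missing link is provided by pairs [x], [x + 3] prime to [3].

    For [n >= 30], a finite computation over residues gives a walk of length
    at most [4] with inner vertices in [1, ..., 30] between any two vertices,
    except when they have opposite parities and are both prime to [3]. In that
    case one of the two can be moved by [3], since this fails only for a vertex
    of the form [5 k + 4] among the last three, and then a common neighbour in
    [1, ..., 30] gives a walk of length [3]. For [n < 30] the claim is checked
    by computation. *)

(** * Adjacency of halved vertices *)

Definition halfadj : rel nat := fun x y =>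
  let s := x + y in let d := (x - y) + (y - x) in
  [&& admissible 3 s, admissible 3 d, admissible 5 s & admissible 5 d].

Definition prime_to_30 (m : nat) : bool :=
  [&& odd m, ~~ (3 %| m) & ~~ (5 %| m)].

(* [2] and [4] stand for [-1] modulo [3] and modulo [5]. *)
Definition resadj : rel nat := fun x y =>
  [&& prime_to_30 (x + y), ~~ (3 %| x + 2 * y) & ~~ (5 %| x + 4 * y)].

Lemma prime_to_30_admissible m :
  prime_to_30 m -> admissible 3 m && admissible 5 m.
Proof.
by case/and3P=> om h3 h5; rewrite /admissible /proper_multiple om
  (negbTE h3) (negbTE h5).
Qed.

Lemma resadj_mod x y : resadj (x %% 30) (y %% 30) = resadj x y.
Proof.
rewrite /resadj /prime_to_30.
have -> : odd (x %% 30 + y %% 30) = odd (x + y) by lia.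
have -> : (3 %| x %% 30 + y %% 30) = (3 %| x + y) by lia.
have -> : (5 %| x %% 30 + y %% 30) = (5 %| x + y) by lia.
have -> : (3 %| x %% 30 + 2 * (y %% 30)) = (3 %| x + 2 * y) by lia.
by have -> : (5 %| x %% 30 + 4 * (y %% 30)) = (5 %| x + 4 * y) by lia.
Qed.

Lemma resadj_modl x y : resadj (x %% 30) y = resadj x y.
Proof. by rewrite -[LHS]resadj_mod modn_mod resadj_mod. Qed.

Lemma resadj_modr x y : resadj x (y %% 30) = resadj x y.
Proof. by rewrite -[LHS]resadj_mod modn_mod resadj_mod. Qed.

Lemma resadj_halfadj x y : resadj x y -> halfadj x y.
Proof.
case/and3P=> s30 h3 h5; have /and3P[odds _ _] := s30.
have /prime_to_30_admissible/andP[s3 s5] := s30.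
have /prime_to_30_admissible/andP[d3 d5] : prime_to_30 ((x - y) + (y - x)).
  by apply/and3P; split; lia.
by rewrite /halfadj s3 s5 d3 d5.
Qed.

Lemma halfadj_sym x y : halfadj x y = halfadj y x.
Proof. by rewrite /halfadj [x + y]addnC [x - y + _]addnC. Qed.

(** * Walks and breadth-first search *)

Definition halfwalk (n k x y : nat) : Prop := exists s : seq nat,
  [/\ size s = k, all (fun z => 0 < z <= n) s, path halfadj x s & last x s = y].

Lemma halfwalk0 n x : halfwalk n 0 x x.
Proof. by exists [::]. Qed.

Lemma halfwalkS n k x y z : halfwalk n k x y -> halfadj y z -> 0 < z <= n ->
  halfwalk n k.+1 x z.
Proof.
case=> s [<- sn ps <-] yz zn; exists (rcons s z).
by rewrite size_rcons all_rcons zn rcons_path ps yz last_rcons.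
Qed.

Lemma halfwalk_cons n k x y z : halfadj x y -> 0 < y <= n ->
  halfwalk n k y z -> halfwalk n k.+1 x z.
Proof.
by move=> xy yn [s [<- sn ps <-]]; exists (y :: s); rewrite /= xy yn.
Qed.

Lemma halfwalk_leq m n k x y : m <= n -> halfwalk m k x y -> halfwalk n k x y.
Proof.
move=> mn [s [ss sm ps ls]]; exists s; split=> //.
by apply: sub_all sm => z /andP[-> zm]; apply: leq_trans mn.
Qed.

Definition nexts (n : nat) (S : seq nat) : seq nat :=
  [seq y <- iota 1 n | has (halfadj^~ y) S].

Lemma nexts_halfwalk n k x S : (forall z, z \in S -> halfwalk n k x z) ->
  forall z, z \in nexts n S -> halfwalk n k.+1 x z.
Proof.
move=> hS z; rewrite mem_filter mem_iota => /andP[/hasP[y /hS xy yz] zn].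
by apply: halfwalkS xy yz _; lia.
Qed.

(** The trajectory lists the search layers that start from [S]; reaching layer [j] takes [j] further
    edges. *)
Lemma traject_nexts_halfwalk n m k x S y :
  (forall z, z \in S -> halfwalk n k x z) ->
  y \in flatten (traject (nexts n) S m) ->
  exists2 j, j < m & halfwalk n (j + k) x y.
Proof.
move=> hS /flattenP[_ /trajectP[j jm ->] yj]; exists j => //.
by elim: j {jm} y yj => //= j; apply: nexts_halfwalk.
Qed.

(* The ends of the walks from [r] of length at most [m] whose vertices after
   [r] are at most [30] and whose first edge depends only on [r] modulo [30]. *)
Definition reslinks (m r : nat) : seq nat :=
  flatten (traject (nexts 30) [seq u <- iota 1 30 | resadj r u] m).

(** Only [x] and [y] may exceed [30]. The edges at them are [resadj] edges, hence determined by
    residues; all other edges join numbers up to [30]. *)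
Lemma reslinks_halfwalk n m x y : 30 <= n -> 0 < y <= n ->
  has (resadj^~ (y %% 30)) (reslinks m (x %% 30)) ->
  exists2 k, k <= m.+1 & halfwalk n k x y.
Proof.
move=> n30 yn /hasP[z zS]; rewrite resadj_modr => /resadj_halfadj zy.
have [u|j jm w] := @traject_nexts_halfwalk 30 m 1 x _ z _ zS.
  rewrite mem_filter resadj_modl mem_iota => /andP[/resadj_halfadj xu un].
  by apply: halfwalkS (halfwalk0 _ _) xu _; lia.
exists (j + 1).+1; first by rewrite addn1.
exact: halfwalkS (halfwalk_leq n30 w) zy yn.
Qed.

(** * Residues modulo 30 and shifts by 3 *)

Lemma reslinks_same_parity_prime_to_3 r s : r < 30 -> s < 30 ->
  odd r = odd s -> ~~ (3 %| r) -> ~~ (3 %| s) ->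
  has (resadj^~ s) (reslinks 1 r).
Proof.
have: all (fun r => let B := reslinks 1 r in
  all (fun s => [&& odd r == odd s, ~~ (3 %| r) & ~~ (3 %| s)] ==>
    has (resadj^~ s) B) (iota 0 30)) (iota 0 30) by vm_compute.
move=> /allP h rn sn rs r3 s3.
have /h/allP/(_ s) : r \in iota 0 30 by rewrite mem_iota.
rewrite mem_iota => /(_ sn)/implyP; apply.
by apply/and3P; split=> //; apply/eqP.
Qed.

Lemma reslinks_generic r s : r < 30 -> s < 30 ->
  [|| odd r == odd s, 3 %| r | 3 %| s] -> has (resadj^~ s) (reslinks 3 r).
Proof.
have: all (fun r => let B := reslinks 3 r in
  all (fun s => [|| odd r == odd s, 3 %| r | 3 %| s] ==>
    has (resadj^~ s) B) (iota 0 30)) (iota 0 30) by vm_compute.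
move=> /allP h rn sn rs.
have /h/allP/(_ s) : r \in iota 0 30 by rewrite mem_iota.
by rewrite mem_iota => /(_ sn)/implyP; apply.
Qed.

(** The difference [3] is admissible, being [3 * 1]. The sum [2 x + 3] is odd, and it is divisible
    by [5] exactly when [x] is [1] modulo [5]. *)
Lemma halfadj_add3 x : ~~ (3 %| x) -> x %% 5 != 1 -> halfadj x (x + 3).
Proof.
move=> x3 x5; rewrite /halfadj.
have /prime_to_30_admissible/andP[-> ->] : prime_to_30 (x + (x + 3)).
  by apply/and3P; split; lia.
by have -> : x - (x + 3) + (x + 3 - x) = 3 by lia.
Qed.

Lemma shift3_neighbour n x : 30 <= n -> 0 < x <= n -> ~~ (3 %| x) ->
  (x + 3 <= n) || (x %% 5 != 4) ->
  exists y, [/\ halfadj x y, 0 < y <= n, ~~ (3 %| y) & odd y = ~~ odd x].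
Proof.
move=> n30 xn x3 h; have [->|x1] := eqVneq x 1.
  (* Here the sum is [5] itself, which is admissible. *)
  by exists 4; split=> //; lia.
have [/andP[le5 x5]|h5] := boolP ((x + 3 <= n) && (x %% 5 != 1)).
  by exists (x + 3); split; rewrite ?halfadj_add3 //; lia.
(* Now [x] is not [4] modulo [5], so [x - 3] is not [1] modulo [5]; it is positive because [x] is
   not [1]. *)
exists (x - 3); split; try lia.
rewrite halfadj_sym -{2}(@subnK 3 x); last lia.
by apply: halfadj_add3; lia.
Qed.

(** * Walks of length at most 4 *)

Lemma halfwalk_large n x y : 30 <= n -> 0 < x <= n -> 0 < y <= n ->
  exists2 k, k <= 4 & halfwalk n k x y.
Proof.
move=> n30 xn yn; have lt30 m : m %% 30 < 30 by rewrite ltn_mod.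
have [g|] := boolP [|| odd x == odd y, 3 %| x | 3 %| y].
  apply: (@reslinks_halfwalk _ 3) => //.
  by apply: reslinks_generic; rewrite ?lt30 //; lia.
rewrite !negb_or => /and3P[xy x3 y3].
have [hx|hx] := boolP ((x + 3 <= n) || (x %% 5 != 4)).
  have [z [xz zn z3 zx]] := shift3_neighbour n30 xn x3 hx.
  have [|k k2 w] := @reslinks_halfwalk n 1 z y n30 yn.
    by apply: reslinks_same_parity_prime_to_3; rewrite ?lt30 //; lia.
  by exists k.+1; [lia | apply: halfwalk_cons w].
(* Otherwise [x] and [y] would both be [4] modulo [5] among the last three numbers, hence equal,
   against their opposite parities. *)
have hy : (y + 3 <= n) || (y %% 5 != 4) by lia.
have [z [yz zn z3 zy]] := shift3_neighbour n30 yn y3 hy.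
have [|k k2 w] := @reslinks_halfwalk n 1 x z n30 zn.
  by apply: reslinks_same_parity_prime_to_3; rewrite ?lt30 //; lia.
by exists k.+1; [lia | apply: halfwalkS w _ yn; rewrite halfadj_sym].
Qed.

Lemma halfwalk_small n x y : n < 30 -> 0 < x <= n -> 0 < y <= n ->
  exists2 k, k <= 4 & halfwalk n k x y.
Proof.
have: all (fun n => all (fun x =>
    (* Five layers, for the lengths [0] to [4]. *)
    let B := flatten (traject (nexts n) [:: x] 5) in all [in B] (iota 1 n))
  (iota 1 n)) (iota 0 30) by vm_compute.
move=> /allP h n30 xn yn.
have /h/allP/(_ x) : n \in iota 0 30 by rewrite mem_iota.
rewrite mem_iota => /(_ xn)/allP/(_ y); rewrite mem_iota => /(_ yn) yB.
have [z|j j5 w] := @traject_nexts_halfwalk n 5 0 x _ y _ yB.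
  by rewrite inE => /eqP->; apply: halfwalk0.
by exists (j + 0); rewrite ?addn0 in w *.
Qed.

Lemma halfwalk_leq4 n x y : 0 < x <= n -> 0 < y <= n ->
  exists2 k, k <= 4 & halfwalk n k x y.
Proof.
by case: (leqP 30 n) => hn; [apply: halfwalk_large | apply: halfwalk_small].
Qed.

(** * Transfer to the graph *)

Definition half_val n (a : vertex n) : nat := (vertex_val a)./2.

Lemma half_valK n (a : vertex n) : (half_val a).*2 = vertex_val a.
Proof.
by rewrite even_halfK //; have /andP[] := valP a.
Qed.

Lemma half_val_inj n : injective (@half_val n).
Proof.
by move=> a b ab; do 2!apply: val_inj; have := half_valK a;
  rewrite ab half_valK.
Qed.

Lemma half_val_bounds n (a : vertex n) : 0 < half_val a <= n.
Proof.
have := half_valK a; have /andP[+ _] := valP a; have := ltn_ord (val a).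
by rewrite /vertex_val /= => h1 h2 h3; lia.
Qed.

Lemma half_val_surj n x : 0 < x <= n -> exists a : vertex n, half_val a = x.
Proof.
move=> xn; have lt : x.*2 < (2 * n).+1 by lia.
have h : (0 < Ordinal lt) && ~~ odd (Ordinal lt) by rewrite /= odd_double; lia.
by exists (Sub (Ordinal lt) h); rewrite /half_val /vertex_val SubK /= doubleK.
Qed.

Lemma edge_halfadj n (a b : vertex n) :
  edge (G35 n) a b = halfadj (half_val a) (half_val b).
Proof.
rewrite /= /adj -!half_valK.
set x := half_val a; set y := half_val b.
have -> : (x.*2 + y.*2) %/ 2 = x + y by lia.
(* Subtraction is truncated, so one of the two summands is zero and the other is the distance. *)
have -> : `|x.*2 - y.*2|%N %/ 2 = x - y + (y - x) by lia.
by rewrite /halfadj -!andbA.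
Qed.

Lemma path_half_val n (a : vertex n) s : all (fun z => 0 < z <= n) s ->
  path halfadj (half_val a) s ->
  exists2 t, map (@half_val n) t = s & path (edge (G35 n)) a t.
Proof.
elim: s a => [|x s IHs] a /=; first by exists [::].
case/andP=> /half_val_surj[b <-] sn /andP[ab /IHs-/(_ sn)[t <- pt]].
by rewrite -edge_halfadj in ab; exists (b :: t) => //; apply/andP.
Qed.

Lemma has_walk_leq4 n (a b : vertex n) :
  exists2 k, k <= 4 & has_walk (G35 n) k a b.
Proof.
have [k k4 [s [sk sn ps ls]]] :=
  halfwalk_leq4 (half_val_bounds a) (half_val_bounds b).
have [t ts pt] := path_half_val sn ps.
exists (size t); first by rewrite -(size_map (@half_val n)) ts sk.
apply/existsP; exists (in_tuple t); rewrite pt /=; apply/eqP.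
by apply: half_val_inj; rewrite -ls -ts last_map.
Qed.

(** If [k] lies in the searched range, the search stops at [k] or before; if not, its value is at
    most [#|T|], hence at most [k]. *)
Lemma sg_dist_leq (T : finType) (G : sgraph T) k x y :
  has_walk G k x y -> sg_dist G x y <= k.
Proof.
move=> w; have [ltk|lek] := ltnP k #|T|.
  rewrite leqNgt; apply/negP => /(before_find 0).
  by rewrite nth_iota // w.
by apply: leq_trans lek; rewrite -[leqRHS](size_iota 0) find_size.
Qed.

Lemma has_walk_connect (T : finType) (G : sgraph T) k x y :
  has_walk G k x y -> connect (edge G) x y.
Proof. by case/existsP=> s /andP[ps /eqP ls]; apply/connectP; exists s. Qed.

Theorem theorem6p2 (n : nat) : sg_connected (G35 n) /\ sg_diam (G35 n) <= 4.
Proof.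
split=> [a b|]; first by have [k _ /has_walk_connect] := has_walk_leq4 a b.
apply/bigmax_leqP => a _; apply/bigmax_leqP => b _.
by have [k k4 /sg_dist_leq/leq_trans] := has_walk_leq4 a b; apply.
Qed.
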